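(* For every finite generating set $X$ of the free inverse monoid $\mathrm{FIM}_1$ of rank $1$, both versions of the co-word problem of $\mathrm{FIM}_1$ are context-free: the language $$\mathrm{coWP}(\mathrm{FIM}_1,X)=\{u\#v^{\mathrm{inv}}\mid u,v\in (X^{\pm})^*,\ u\neq_{\mathrm{FIM}_1} v\}$$ is context-free, and the two-tape co-word problem $$\{(u,v)\in (X^{\pm})^*\times (X^{\pm})^*\mid u\neq_{\mathrm{FIM}_1} v\}$$ is a context-free relation.
   Context: A monoid $M$ is inverse if for every $x\in M$ there is a unique $y\in M$ (the inverse $x^{-1}$ of $x$) with $xyx=x$ and $yxy=y$. For a set $X$, let $X^{-1}=\{\overline{x}\mid x\in X\}$ be a disjoint set of formal inverses and $X^{\pm}=X\cup X^{-1}$; put $x^{-1}=\overline{x}$ and $\overline{x}^{-1}=x$ for $x\in X$, and for a word $w=w_1\cdots w_n$ with $w_i\in X^{\pm}$ put $w^{\mathrm{inv}}=w_n^{-1}\cdots w_1^{-1}$. The free inverse monoid $\mathrm{FIM}(X)$ is the free object on $X$ in the variety of inverse monoids, i.e. the quotient of $(X^{\pm})^*$ by the relations $u=uu^{\mathrm{inv}}u$ and $uu^{\mathrm{inv}}vv^{\mathrm{inv}}=vv^{\mathrm{inv}}uu^{\mathrm{inv}}$ for $u,v\in (X^{\pm})^*$. If $|X|=k$ it is denoted $\mathrm{FIM}_k$. If $M$ is an inverse monoid and $X\subseteq M$ is a finite set generating $M$ as an inverse monoid, words over $X^{\pm}$ are evaluated in $M$ by interpreting $\overline{x}$ as the inverse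 of $x$, and $u\neq_M v$ means that $u$ and $v$ represent different elements of $M$. The symbol $\#$ is not in $X^{\pm}$. A relation $R\subseteq A^*\times A^*$ ($A$ a finite alphabet) is called context-free if it is accepted by a nondeterministic two-tape pushdown automaton (one stack, two one-way input tapes read asynchronously); equivalently, if $R$ is the image of a context-free language over the alphabet $\{(a,\varepsilon),(\varepsilon,a)\mid a\in A\}$ under the natural homomorphism to $A^*\times A^*$. *)

(* Defs.v *)
From HB Require Import structures.
From Stdlib Require Import Relation_Operators.
From mathcomp Require Import all_boot.
From mathcomp Require Import finmap generic_quotient boolp.

Set Implicit Arguments.
Unset Strict Implicit.
Unset Printing Implicit Defensive.

Local Open Scope group_scope.

(* Extending [starMonoidType] costs no generality: in an inverse monoid,
   x^-1^-1 = x and (x * y)^-1 = y^-1 * x^-1. *)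
HB.mixin Record isInverseMonoid M of StarMonoid M := {
  invm_mulVK : forall x : M, x * x^-1 * x = x;
  invm_mulKV : forall x : M, x^-1 * x * x^-1 = x^-1;
  invm_uniq : forall x y : M, x * y * x = x -> y * x * y = y -> y = x^-1
}.

#[short(type="invMonoidType")]
HB.structure Definition InverseMonoid := {M of isInverseMonoid M & StarMonoid M}.

(* [inl x] is the generator x, [inr x] its formal inverse. *)
Definition pm (X : Type) : Type := (X + X)%type.

Definition pm_inv (X : Type) (a : pm X) : pm X :=
  match a with inl x => inr x | inr x => inl x end.

Definition winv (X : Type) (w : seq (pm X)) : seq (pm X) :=
  rev (map (@pm_inv X) w).

Lemma pm_invK (X : Type) : involutive (@pm_inv X).
Proof. by case. Qed.

Lemma winvK (X : Type) : involutive (@winv X).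
Proof.
move=> w; rewrite /winv map_rev revK -map_comp -[RHS]map_id.
by apply: eq_map => a /=; exact: pm_invK.
Qed.

Lemma winv_cat (X : Type) (u v : seq (pm X)) :
  winv (u ++ v) = winv v ++ winv u.
Proof. by rewrite /winv map_cat rev_cat. Qed.

(* The monoid congruence on (X^±)^* generated by Wagner's relations. *)
Inductive fim_cong (X : Type) : seq (pm X) -> seq (pm X) -> Prop :=
| fim_refl u : fim_cong u u
| fim_sym u v : fim_cong u v -> fim_cong v u
| fim_trans u v w : fim_cong u v -> fim_cong v w -> fim_cong u w
| fim_cat u u' v v' :
    fim_cong u u' -> fim_cong v v' -> fim_cong (u ++ v) (u' ++ v')
| fim_reg u : fim_cong u (u ++ winv u ++ u)
| fim_comm u v : fim_cong (u ++ winv u ++ v ++ winv v)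
                          (v ++ winv v ++ u ++ winv u).

Section FIM.
Variable X : choiceType.
Implicit Types u v w : seq (X + X)%type.

Definition fim_congb : rel (seq (X + X)%type) := fun u v => `[< fim_cong u v >].

Lemma fim_congb_refl : reflexive fim_congb.
Proof. by move=> u; apply/asboolP; exact: fim_refl. Qed.

Lemma fim_congb_sym : symmetric fim_congb.
Proof.
by move=> u v; apply/asboolP/asboolP => h; exact: fim_sym.
Qed.

Lemma fim_congb_trans : transitive fim_congb.
Proof.
by move=> v u w /asboolP uv /asboolP vw; apply/asboolP; exact: fim_trans uv vw.
Qed.

Canonical fim_equiv :=
  EquivRel fim_congb fim_congb_refl fim_congb_sym fim_congb_trans.

Definition FIM : Type := {eq_quot fim_congb}%qT.

HB.instance Definition _ := Choice.on FIM.
HB.instance Definition _ := EqQuotient.on FIM.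

Definition fim_class (w : seq (X + X)%type) : FIM := \pi_FIM%qT w.

Lemma fim_classP u v : fim_class u = fim_class v <-> fim_cong u v.
Proof.
split=> [/eqP|uv]; first by rewrite /fim_class piE => /asboolP.
by apply/eqP; rewrite /fim_class piE; apply/asboolP.
Qed.

Lemma fim_reprK (x : FIM) : fim_class (repr x) = x.
Proof. exact: reprK. Qed.

Lemma fim_repr_class w : fim_cong (repr (fim_class w)) w.
Proof. by apply/fim_classP; exact: fim_reprK. Qed.

Lemma winv_cong u v : fim_cong u v -> fim_cong (winv u) (winv v).
Proof.
elim=> {u v}.
- by move=> u; exact: fim_refl.
- by move=> u v _; exact: fim_sym.
- by move=> u v w _ uv _; exact: fim_trans uv.
- by move=> u u' v v' _ uu' _ vv'; rewrite !winv_cat; exact: fim_cat.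
- by move=> u; rewrite !winv_cat -catA; exact: fim_reg.
- move=> u v; rewrite !winv_cat !winvK -!catA; exact: fim_comm.
Qed.

Definition fim_one : FIM := fim_class [::].
Definition fim_mul (x y : FIM) : FIM := fim_class (repr x ++ repr y).
Definition fim_inv (x : FIM) : FIM := fim_class (winv (repr x)).

Lemma fim_mulE u v : fim_mul (fim_class u) (fim_class v) = fim_class (u ++ v).
Proof. by apply/fim_classP; apply: fim_cat; exact: fim_repr_class. Qed.

Lemma fim_invE u : fim_inv (fim_class u) = fim_class (winv u).
Proof. by apply/fim_classP; apply: winv_cong; exact: fim_repr_class. Qed.

Lemma fim_mulA : associative fim_mul.
Proof.
move=> x y z; rewrite -[x]fim_reprK -[y]fim_reprK -[z]fim_reprK.
by rewrite !fim_mulE catA.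
Qed.

Lemma fim_mul1g : left_id fim_one fim_mul.
Proof. by move=> x; rewrite -[x]fim_reprK fim_mulE. Qed.

Lemma fim_invK : involutive fim_inv.
Proof. by move=> x; rewrite -[x]fim_reprK !fim_invE winvK. Qed.

Lemma fim_invM : {morph fim_inv : x y / fim_mul x y >-> fim_mul y x}.
Proof.
move=> x y; rewrite -[x]fim_reprK -[y]fim_reprK.
by rewrite fim_mulE !fim_invE fim_mulE winv_cat.
Qed.

HB.instance Definition _ :=
  isStarMonoid.Build FIM fim_mulA fim_mul1g fim_invK fim_invM.

Lemma fim_class_cat u v : fim_class (u ++ v) = fim_class u * fim_class v.
Proof. by rewrite -fim_mulE. Qed.

Lemma fim_class_inv u : fim_class (winv u) = (fim_class u)^-1.
Proof. by rewrite -fim_invE. Qed.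

Implicit Types x y e f : FIM.

Lemma fim_mulVK x : x * x^-1 * x = x.
Proof.
rewrite -[x]fim_reprK -fim_class_inv -!fim_class_cat -catA.
by apply/fim_classP/fim_sym; exact: fim_reg.
Qed.

Lemma fim_mulKV x : x^-1 * x * x^-1 = x^-1.
Proof. by have := fim_mulVK x^-1; rewrite invgK. Qed.

Lemma fim_mulVC x y : x * x^-1 * (y * y^-1) = y * y^-1 * (x * x^-1).
Proof.
rewrite -[x]fim_reprK -[y]fim_reprK -!fim_class_inv -!fim_class_cat -!catA.
by apply/fim_classP; exact: fim_comm.
Qed.

Lemma fim_idem e : e * e = e -> e = e * e^-1.
Proof.
move=> ee.
have comm : e^-1 * e * (e * e^-1) = e * e^-1 * (e^-1 * e).
  by have := fim_mulVC e^-1 e; rewrite invgK.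
have eV : e^-1 = e * e^-1 * (e^-1 * e).
  by rewrite -comm mulgA -[_ * e * e]mulgA ee fim_mulKV.
have eVe : e * e^-1 = e^-1.
  by rewrite [in LHS]eV !mulgA ee -[e * _ * _ * e]mulgA -eV.
have eeV : e^-1 * e = e^-1.
  by rewrite [in LHS]eV -!mulgA ee !mulgA -[e * _ * _ * e]mulgA -eV.
by rewrite eVe -[LHS]fim_mulVK eVe eeV.
Qed.

Lemma fim_idemC e f : e * e = e -> f * f = f -> e * f = f * e.
Proof. by move=> /fim_idem -> /fim_idem ->; exact: fim_mulVC. Qed.

Lemma fim_inv_uniq x y : x * y * x = x -> y * x * y = y -> y = x^-1.
Proof.
move=> xyx yxy; have xVx := fim_mulVK x; have VxV := fim_mulKV x.
have i1 : y * x * (y * x) = y * x by rewrite mulgA yxy.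
have i2 : x^-1 * x * (x^-1 * x) = x^-1 * x by rewrite mulgA VxV.
have j1 : x * y * (x * y) = x * y by rewrite mulgA xyx.
have j2 : x * x^-1 * (x * x^-1) = x * x^-1 by rewrite mulgA xVx.
have hl : y * x = x^-1 * x.
  have -> : y * x = y * x * (x^-1 * x) by rewrite -[in LHS]xVx !mulgA.
  by rewrite (fim_idemC i1 i2) -!mulgA [x * (y * x)]mulgA xyx.
have hr : x * y = x * x^-1.
  have -> : x * y = x * x^-1 * (x * y) by rewrite mulgA xVx.
  by rewrite (fim_idemC j2 j1) mulgA xyx.
by rewrite -yxy hl -mulgA hr mulgA VxV.
Qed.

HB.instance Definition _ :=
  isInverseMonoid.Build FIM fim_mulVK fim_mulKV fim_inv_uniq.

End FIM.

Notation "'FIM_ k" := (FIM 'I_k) (at level 8, k at level 2, format "''FIM_' k").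

Section CoWP.
Variables (M : invMonoidType) (X : {fset M}).

(* Closure under 1, products and inverses: no proper inverse submonoid
   contains X. *)
Definition inv_generates : Prop :=
  forall S : M -> Prop,
    S 1 -> (forall x y, S x -> S y -> S (x * y)) ->
    (forall x, S x -> S x^-1) -> (forall x, x \in X -> S x) ->
  forall m, S m.

Definition pm_val (a : X + X) : M :=
  match a with inl x => val x | inr x => (val x)^-1 end.

Definition weval (w : seq (X + X)) : M := \prod_(a <- w) pm_val a.

(* Over the alphabet [option (X + X)], where [None] is the separator #. *)
Definition coWP (w : seq (option (X + X))) : Prop :=
  exists u v : seq (X + X),
    weval u <> weval v /\ w = map Some u ++ None :: map Some (winv v).

Definition coWP2 (u v : seq (X + X)) : Prop := weval u <> weval v.

End CoWP.

Arguments inv_generates {M} X.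
Arguments coWP {M} X w.
Arguments coWP2 {M} X u v.

Record cfg (T : finType) := CFG {
  cfg_nonterm : finType;
  cfg_start : cfg_nonterm;
  cfg_rules : seq (cfg_nonterm * seq (cfg_nonterm + T))
}.

Inductive cfg_step (T : finType) (G : cfg T) :
  seq (cfg_nonterm G + T) -> seq (cfg_nonterm G + T) -> Prop :=
| CfgStep A rhs l r : (A, rhs) \in cfg_rules G ->
    cfg_step (l ++ inl A :: r) (l ++ rhs ++ r).

Definition cfg_lang (T : finType) (G : cfg T) (w : seq T) : Prop :=
  clos_refl_trans _ (@cfg_step T G) [:: inl (cfg_start G)] (map inr w).

Definition context_free_language (T : finType) (L : seq T -> Prop) : Prop :=
  exists G : cfg T, forall w, L w <-> cfg_lang G w.

(* A transition (q, a, b, Z, q', g) is enabled in state q with Z on top of the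
   stack; it reads a on the first tape and b on the second one ([None] reads
   nothing), moves to q' and replaces Z by g. *)
Record pda2 (T : finType) := PDA2 {
  pda_state : finType;
  pda_stack : finType;
  pda_init : pda_state;
  pda_bottom : pda_stack;
  pda_final : {set pda_state};
  pda_trans : seq (pda_state * option T * option T * pda_stack
                   * pda_state * seq pda_stack)
}.

(* State, unread parts of the two tapes, stack (top first). *)
Definition pda_config (T : finType) (P : pda2 T) : Type :=
  (pda_state P * seq T * seq T * seq (pda_stack P))%type.

Inductive pda_step (T : finType) (P : pda2 T) :
  pda_config P -> pda_config P -> Prop :=
| PdaStep q a b Z q' g u v s : (q, a, b, Z, q', g) \in pda_trans P ->
    pda_step (q, seq_of_opt a ++ u, seq_of_opt b ++ v, Z :: s)
             (q', u, v, g ++ s).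

Definition pda_accepts (T : finType) (P : pda2 T) (u v : seq T) : Prop :=
  exists (f : pda_state P) (s : seq (pda_stack P)),
    f \in pda_final P /\
    clos_refl_trans _ (@pda_step T P)
      (pda_init P, u, v, [:: pda_bottom P]) (f, [::], [::], s).

Definition context_free_relation (T : finType) (R : seq T -> seq T -> Prop) :
    Prop :=
  exists P : pda2 T, forall u v, R u v <-> pda_accepts P u v.

(* Main.v *)
(* Words over the generators of FIM_1 = <x> are read as walks on the integers, and
   by Munn's description an element is determined by the end point, the maximum
   and the minimum of the walk. So two words differ iff, up to exchanging x and
   x^-1, the end points satisfy a strict inequality, or the maxima do. Each of
   these conditions is checked by a nondeterministic one-counter automaton. For
   u # v^inv the second walk is read backwards, and there the maximum is measured
   from the end point of the walk: this is enough, because when the maxima differ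
   but the relative maxima do not, the end points already differ. Words over a
   finite generating set are handled by substituting representatives over x^±1. *)

From Stdlib Require Import Relation_Operators Operators_Properties.
Require Import Defs.
From mathcomp Require Import all_boot all_order ssralg ssrnum ssrint.
From mathcomp Require Import finmap boolp zify.

Set Implicit Arguments.
Unset Strict Implicit.
Unset Printing Implicit Defensive.

Import Order.TTheory GRing.Theory.

(** * Context-free grammars *)

Section Grammar.
Variables (T : finType) (G : cfg T).
Local Notation sym := (cfg_nonterm G + T)%type.
Implicit Types (s : seq sym) (w : seq T).

(* Leftmost derivations of terminal words. *)
Inductive gen : seq sym -> seq T -> Prop :=
| gen_nil : gen [::] [::]
| gen_term a s w : gen s w -> gen (inr a :: s) (a :: w)
| gen_rule A rhs s w :
    (A, rhs) \in cfg_rules G -> gen (rhs ++ s) w -> gen (inl A :: s) w.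

Lemma gen_cat s1 s2 w1 w2 : gen s1 w1 -> gen s2 w2 -> gen (s1 ++ s2) (w1 ++ w2).
Proof.
move=> + g2; elim=> //= [a s w _|A rhs s w Ar _]; first exact: gen_term.
by rewrite -catA; exact: gen_rule.
Qed.

Lemma gen_catP s1 s2 w : gen (s1 ++ s2) w ->
  exists w1 w2, [/\ w = w1 ++ w2, gen s1 w1 & gen s2 w2].
Proof.
move E: (s1 ++ s2) => s g; elim: g s1 E => {s w}.
- by case=> //= ->; exists [::], [::]; split; constructor.
- move=> a s w g IH [|b s1] /= E.
    by exists [::], (a :: w); rewrite E; split; constructor.
  case: E => -> /IH [w1 [w2 [-> g1 g2]]].
  by exists (a :: w1), w2; split=> //; exact: gen_term.
- move=> A rhs s w Ar g IH [|b s1] /= E.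
    by exists [::], w; rewrite E; split=> //; [constructor|apply: gen_rule g].
  case: E IH => -> <- IH; have [|w1 [w2 [-> g1 g2]]] := IH (rhs ++ s1).
    by rewrite catA.
  by exists w1, w2; split=> //; exact: gen_rule g1.
Qed.

Lemma gen_inr w : gen (map inr w) w.
Proof. by elim: w => [|a w IH] /=; constructor. Qed.

Lemma cfg_langE w : cfg_lang G w <-> gen [:: inl (cfg_start G)] w.
Proof.
rewrite /cfg_lang; move: [:: _] => s; split.
  move E: (map inr w) => t /(@clos_rt_rt1n _ _ _ _) st.
  elim: st E => [_ <-|s1 s2 z [A rhs l r Ar] _ IH /IH]; first exact: gen_inr.
  move=> /gen_catP[w1 [w2 [-> g1 g2]]].
  by apply: gen_cat g1 _; apply: gen_rule g2.
(* The induction carries the terminal prefix [p] that the leftmost derivation has already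
   produced. *)
move=> g; rewrite -[s]/(map inr (Nil T) ++ s) -[w]/([::] ++ w).
elim: g [::] => {s w} [p|a s w _ IH p|A rhs s w Ar _ IH p].
- by rewrite !cats0; exact: rt_refl.
- by rewrite -!cat_rcons -map_rcons; exact: IH.
- by apply: rt_trans (IH p); apply: rt_step; exact: CfgStep.
Qed.

Fixpoint interp (P : cfg_nonterm G -> seq T -> Prop) s w : Prop :=
  match s with
  | [::] => w = [::]
  | inr a :: s' => exists2 w', w = a :: w' & interp P s' w'
  | inl A :: s' => exists w1 w2, [/\ w = w1 ++ w2, P A w1 & interp P s' w2]
  end.

Lemma interp_catP P s1 s2 w : interp P (s1 ++ s2) w ->
  exists w1 w2, [/\ w = w1 ++ w2, interp P s1 w1 & interp P s2 w2].
Proof.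
elim: s1 w => [|[A|a] s1 IH] w /=; first by exists [::], w.
  move=> [w1 [w2 [-> pA /IH [w3 [w4 [-> i3 i4]]]]]].
  by exists (w1 ++ w3), w4; rewrite catA; split=> //; exists w1, w3.
move=> [w' -> /IH [w3 [w4 [-> i3 i4]]]].
by exists (a :: w3), w4; split=> //; exists w3.
Qed.

(** The derived languages are the least family closed under the rules, so every closed family [P]
    contains them. Soundness of the grammars below is shown by choosing [P]. *)
Lemma gen_interp (P : cfg_nonterm G -> seq T -> Prop) :
  (forall A rhs w, (A, rhs) \in cfg_rules G -> interp P rhs w -> P A w) ->
  forall s w, gen s w -> interp P s w.
Proof.
move=> PG s w; elim=> //= {s w} [a s w _|A rhs s w Ar _]; first by exists w.
by move=> /interp_catP[w1 [w2 [-> i1 i2]]]; exists w1, w2; split=> //; exact: PG i1.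
Qed.

Lemma gen_interp1 (P : cfg_nonterm G -> seq T -> Prop) :
  (forall A rhs w, (A, rhs) \in cfg_rules G -> interp P rhs w -> P A w) ->
  forall A w, gen [:: inl A] w -> P A w.
Proof.
by move=> PG A w /(gen_interp PG) /= [w1 [w2 [-> ? ->]]]; rewrite cats0.
Qed.

End Grammar.

(** The grammar is the disjoint union of the given ones with a fresh start symbol [None] that
    chooses the index. *)
Lemma context_free_bigcup (T I : finType) (L : I -> seq T -> Prop) :
  (forall i, context_free_language (L i)) ->
  context_free_language (fun w => exists i, L i w).
Proof.
move=> /choice[G GL].
pose N : finType := {i : I & cfg_nonterm (G i)}.
pose tg i (A : cfg_nonterm (G i)) : N := Tagged (fun i => cfg_nonterm (G i)) A.
pose emb i (x : cfg_nonterm (G i) + T) : option N + T :=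
  match x with inl A => inl (Some (tg i A)) | inr a => inr a end.
pose rules : seq (option N * seq (option N + T)) :=
  [seq (None, [:: inl (Some (tg i (cfg_start (G i))))]) | i <- enum I] ++
  flatten [seq [seq (Some (tg i r.1), map (@emb i) r.2)
    | r <- cfg_rules (G i)] | i <- enum I].
pose H := CFG None rules; exists H => w; rewrite cfg_langE; split.
  move=> [i /GL /cfg_langE g]; apply: (@gen_rule _ H _ [:: _]).
    by rewrite mem_cat; apply/orP; left; apply/mapP; exists i; rewrite ?mem_enum.
  rewrite cats0; have {g}: @gen T H (map (@emb i) [:: inl (cfg_start (G i))]) w; last by [].
  elim: g => [|a s {}w _ IH|A rhs s {}w Ar _ IH] /=; try by constructor.
  apply: (@gen_rule _ H _ (map (@emb i) rhs)); last by rewrite -map_cat.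
  rewrite mem_cat; apply/orP; right; apply/flatten_mapP; exists i; rewrite ?mem_enum //.
  by apply/mapP; exists (A, rhs).
pose P (A : cfg_nonterm H) v :=
  if A is Some B then @gen T (G (tag B)) [:: inl (tagged B)] v else exists i, L i v.
apply: (@gen_interp1 _ H P) => A rhs {}w; rewrite mem_cat => /orP[].
  move=> /mapP[i _ [-> ->]] /= [w1 [w2 [-> g ->]]]; rewrite cats0.
  by exists i; apply/GL/cfg_langE.
move=> /flatten_mapP[i _ /mapP[[B s] Bs [-> ->]]] /= ht.
rewrite -[w]cats0 in ht *.
apply: gen_rule Bs _; rewrite !cats0 in ht *.
elim: s w ht => [|[C|a] s IH] w /=; first by move=> ->; constructor.
  by move=> [w1 [w2 [-> g /IH g2]]]; exact: gen_cat g g2.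
by move=> [w' -> /IH]; exact: gen_term.
Qed.

(* The automaton is a top-down parser that reads the pair [tau a] when it matches
   the terminal [a]. *)
Lemma context_free_relation_of_language (T U : finType) (tau : U -> option T * option T)
    (L : seq U -> Prop) (R : seq T -> seq T -> Prop) :
  context_free_language L ->
  (forall u v, R u v <-> exists l, [/\ L l, u = pmap (fun a => (tau a).1) l
                                     & v = pmap (fun a => (tau a).2) l]) ->
  context_free_relation R.
Proof.
move=> [G GL] RL; pose N := cfg_nonterm G.
(* State [None] is initial, [Some false] parses and [Some true] accepts. The stack symbol [None]
   marks the bottom, so acceptance requires that the whole sentential form has been consumed. *)
pose trans : seq (option bool * option T * option T * option (N + U)
                   * option bool * seq (option (N + U))) :=
  [:: (None, None, None, None, Some false, [:: Some (inl (cfg_start G)); None]);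
      (Some false, None, None, None, Some true, [::])] ++
  [seq (Some false, None, None, Some (inl r.1), Some false, map Some r.2)
    | r <- cfg_rules G] ++
  [seq (Some false, (tau a).1, (tau a).2, Some (inr a), Some false, [::])
    | a <- enum U].
pose P := PDA2 None None [set Some true] trans; exists P => u v.
pose derives s x y := exists l, [/\ @gen U G s l, x = pmap (fun a => (tau a).1) l
  & y = pmap (fun a => (tau a).2) l].
have -> : R u v <-> derives [:: inl (cfg_start G)] u v.
  rewrite RL; split=> -[l [hl -> ->]]; exists l; split=> //.
    by apply/cfg_langE/GL.
  by apply/GL/cfg_langE.
have pmapE (f : U -> option T) a l : pmap f (a :: l) = seq_of_opt (f a) ++ pmap f l.
  by rewrite /=; case: (f a).
split.
  move=> [l [g -> ->]]; exists (Some true), [::]; split; first by rewrite inE.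
  apply: rt_trans; first apply: rt_step.
    by apply: (@PdaStep _ P None None None None (Some false)
      [:: Some (inl (cfg_start G)); None] _ _ [::]); rewrite !inE eqxx.
  rewrite -[_ ++ [::]]/(map Some [:: inl (cfg_start G)] ++ [:: None]).
  elim: g => {l} [|a s l _ IH|A rhs s l Ar _ IH].
  - apply: rt_step.
    apply: (@PdaStep _ P (Some false) None None None (Some true) [::] _ _ [::]).
    by rewrite !inE eqxx orbT.
  - apply: rt_trans IH; apply: rt_step; rewrite !pmapE.
    apply: (@PdaStep _ P _ _ _ (Some (inr a)) _ [::]).
    rewrite !mem_cat; apply/orP; right; apply/orP; right.
    by apply/mapP; exists a; rewrite ?mem_enum.
  - apply: rt_trans IH; apply: rt_step; rewrite map_cat -catA.
    apply: (@PdaStep _ P (Some false) None None (Some (inl A)) (Some false) (map Some rhs)).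
    rewrite !mem_cat; apply/orP; right; apply/orP; left.
    by apply/mapP; exists (A, rhs).
(* [Inv] describes the unread tapes of a configuration that leads to acceptance; it is propagated
   backwards along the run. *)
pose Inv (c : pda_config P) := let: (q, x, y, s) := c in
  match q with
  | None => s = [:: None] -> derives [:: inl (cfg_start G)] x y
  | Some false => forall t, s = map Some t ++ [:: None] -> derives t x y
  | Some true => x = [::] /\ y = [::]
  end.
suff inv c c' : clos_refl_trans_1n _ (@pda_step T P) c c' ->
    c'.1.1.1 \in pda_final P -> c'.1.1.2 = [::] -> c'.1.2 = [::] -> Inv c.
  by move=> [f [s [ff /(@clos_rt_rt1n _ _ _ _)/inv]]] /=; apply.
elim=> {c c'} [[[[q x] y] s] /=|c1 c2 c3 st _ IH qf x0 y0].
  by rewrite inE => /eqP -> -> ->.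
move: {IH qf x0 y0}(IH qf x0 y0); case: st => q a b Z q' g x y s.
rewrite !mem_cat !inE -!orbA => /or4P[/eqP[-> -> -> -> -> ->]|/eqP[-> -> -> -> -> ->]||].
- move=> /= H [s0]; rewrite s0 in H; exact: (H [:: inl _]).
- move=> /= [-> ->] [|t0 t] //= _; exists [::]; split=> //; constructor.
- move=> /mapP[[A rhs] /= Ar [-> -> -> -> -> ->]] /= H [|t0 t] //= [<- st].
  have [|l [gl -> ->]] := H (rhs ++ t); first by rewrite map_cat -catA st.
  by exists l; split=> //; exact: gen_rule gl.
- move=> /mapP[d _ [-> -> -> -> -> ->]] /= H [|t0 t] //= [<- /H[l [gl -> ->]]].
  by exists (d :: l); rewrite !pmapE; split=> //; exact: gen_term.
Qed.

(** * One-counter automata *)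

Definition step (s : bool) : int := (if s then 1 else -1)%R.
Definition weight (d : option bool) : int := if d is Some s then step s else 0%R.

(* The counter has to be nonnegative only in the states marked by [oca_nonneg], and
   there are no zero tests: with the closure condition below this keeps the runs
   from height 0 to height 0 context-free. *)
Record oca (T : finType) := OCA {
  oca_state : finType;
  oca_edge : oca_state -> option T -> option bool -> oca_state -> bool;
  oca_nonneg : pred oca_state;
  oca_nonneg_edge : forall q a d q',
    oca_edge q a d q' -> oca_nonneg q -> oca_nonneg q'
}.

Section OCA.
Variables (T : finType) (M : oca T).
Local Notation Q := (oca_state M).
Local Notation edge := (@oca_edge T M).
Local Notation nonneg := (@oca_nonneg T M).
Implicit Types (q : Q) (z : int) (w : seq T).


(** The sign condition is tested where an edge arrives, never at the start; lemmas that need it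
    there assume [nonneg q -> 0 <= z]. *)
Inductive run : Q -> int -> seq T -> Q -> int -> Prop :=
| run_nil q z : run q z [::] q z
| run_cons q z a d q1 w q' z' :
    edge q a d q1 -> (nonneg q1 -> 0 <= z + weight d)%R ->
    run q1 (z + weight d)%R w q' z' -> run q z (seq_of_opt a ++ w) q' z'.

Lemma run_cat q1 z1 w1 q2 z2 w2 q3 z3 :
  run q1 z1 w1 q2 z2 -> run q2 z2 w2 q3 z3 -> run q1 z1 (w1 ++ w2) q3 z3.
Proof.
elim=> //= {q1 z1 w1 q2 z2} q z a d q1 w q' z' e n _ IH /IH.
by rewrite -catA; exact: run_cons e n.
Qed.

Lemma run_nonneg q z w q' z' : run q z w q' z' -> nonneg q -> nonneg q'.
Proof. by elim=> //= {}q {}z a d q1 {}w {}q' {}z' e _ _ IH /(oca_nonneg_edge e). Qed.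

(** The last family pairs a step off the current level with a later step back. An excursion
    downwards must end in an unmarked [q2]; as marks persist along edges, all its states are then
    unmarked. *)
Definition oca_cfg_rules (q0 qf : Q) :
    seq (option (Q * Q) * seq (option (Q * Q) + T)) :=
  (None, [:: inl (Some (q0, qf))]) ::
  [seq (Some (q, q), [::]) | q <- enum Q] ++
  [seq (let: (q, a, q1, q') := t in
        (Some (q, q'), map inr (seq_of_opt a) ++ [:: inl (Some (q1, q'))]))
    | t <- enum {: Q * option T * Q * Q} & let: (q, a, q1, q') := t in edge q a None q1] ++
  [seq (let: (q, a, q1, _, q2, b, q3, q') := t in
        (Some (q, q'), map inr (seq_of_opt a) ++ inl (Some (q1, q2)) ::
           map inr (seq_of_opt b) ++ [:: inl (Some (q3, q'))]))
    | t <- enum {: Q * option T * Q * bool * Q * option T * Q * Q} &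
        let: (q, a, q1, s, q2, b, q3, q') := t in
        [&& edge q a (Some s) q1, edge q2 b (Some (~~ s)) q3 & s || ~~ nonneg q2]].

(* [Some (q, q')] derives the words labelling the runs from q to q' that leave
   the counter unchanged. *)
Definition oca_cfg (q0 qf : Q) : cfg T := CFG None (oca_cfg_rules q0 qf).

Section Correct.
Variables q0 qf : Q.
Local Notation G := (oca_cfg q0 qf).
Local Notation D q q' := (@gen T G [:: inl (Some (q, q'))]).

Let D0 q : D q q [::].
Proof.
apply: (@gen_rule _ G _ [::]); last by constructor.
by rewrite !inE mem_cat map_f ?mem_enum // orbT.
Qed.

Let D1 q a q1 q' w : edge q a None q1 -> D q1 q' w -> D q q' (seq_of_opt a ++ w).
Proof.
move=> e g; apply: (@gen_rule _ G _ (map inr (seq_of_opt a) ++ [:: inl (Some (q1, q'))])).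
  rewrite !inE !mem_cat; apply/orP; right; apply/orP; right; apply/orP; left.
  by apply/mapP; exists (q, a, q1, q'); rewrite // mem_filter e mem_enum.
by rewrite cats0; apply: gen_cat => //; exact: gen_inr.
Qed.

Let D2 q a s q1 q2 b q3 q' w1 w2 :
  edge q a (Some s) q1 -> edge q2 b (Some (~~ s)) q3 -> s || ~~ nonneg q2 ->
  D q1 q2 w1 -> D q3 q' w2 ->
  D q q' (seq_of_opt a ++ w1 ++ seq_of_opt b ++ w2).
Proof.
move=> e1 e2 n g1 g2; apply: (@gen_rule _ G _ (map inr (seq_of_opt a) ++
   inl (Some (q1, q2)) :: map inr (seq_of_opt b) ++ [:: inl (Some (q3, q'))])).
  rewrite !inE !mem_cat; apply/orP; right; apply/orP; right; apply/orP; right.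
  by apply/mapP; exists (q, a, q1, s, q2, b, q3, q'); rewrite // mem_filter e1 e2 n mem_enum.
rewrite cats0; apply: gen_cat; first exact: gen_inr.
by apply: (gen_cat g1); apply: gen_cat => //; exact: gen_inr.
Qed.

(** A sign hypothesis at the end suffices: a mark met earlier persists up to [q'], and the run
    starts and ends at the same height. *)
Lemma oca_cfg_sound q q' w z : D q q' w ->
  (nonneg q' -> 0 <= z)%R -> run q z w q' z.
Proof.
pose P (A : cfg_nonterm G) v := if A is Some (p, p') then
  forall z, (nonneg p' -> 0 <= z)%R -> run p z v p' z else True.
move=> g; move: z; apply: (@gen_interp1 _ G P _ (Some (q, q')) w g) => {q q' w g} A rhs w.
have opt a s v : @interp T G P (map inr (seq_of_opt a) ++ s) v ->
    exists2 v', v = seq_of_opt a ++ v' & @interp T G P s v'.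
  by case: a => [a|] //= i; exists v.
have dd p p' s v : @interp T G P (inl (Some (p, p')) :: s) v ->
    exists v1 v2, [/\ v = v1 ++ v2,
     forall z, (nonneg p' -> 0 <= z)%R -> run p z v1 p' z & @interp T G P s v2].
  by [].
rewrite !inE !mem_cat => /or4P[/eqP[-> ->] //||/mapP[[[[p a] p1] p']]|].
- by move=> /mapP[p _ [-> ->]] /= -> z _; constructor.
- rewrite mem_filter => /andP[e _] [-> ->] /opt[v -> /dd[v1 [v2 [-> r ->]]]] z n.
  rewrite cats0; apply: run_cons e _ _ => /=; rewrite addr0; last exact: r.
  by move=> /(run_nonneg (r _ n))/n.
- move=> /mapP[[[[[[[[p a] p1] s] p2] b] p3] p']].
  rewrite mem_filter => /andP[/and3P[e1 e2 np2] _] [-> ->].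
  move=> /opt[v -> /dd[v1 [v2 [-> r1 /opt[v3 -> /dd[v4 [v5 [-> r2 ->]]]]]]]] z n.
  rewrite cats0; have r3 := r2 z n.
  have n2 : (nonneg p2 -> 0 <= z + step s)%R.
    move=> h2; move: np2; rewrite h2 orbF => ->.
    suff: (0 <= z)%R by rewrite /step; lia.
    by apply/n/(run_nonneg r3)/(oca_nonneg_edge e2).
  have r4 := r1 _ n2.
  apply: run_cons e1 _ _ => [h1|]; first exact/n2/(run_nonneg r4).
  apply: run_cat r4 _; apply: run_cons e2 _ _.
    move=> h3; suff: (0 <= z)%R by rewrite /step; case: (s) => /=; lia.
    exact/n/(run_nonneg r3).
  rewrite (_ : (_ + _ + _)%R = z) //; rewrite /step; case: (s) => /=; lia.
Qed.

(* [levels s n q w] cuts a run from counter value n (if s) or -n (if not) to 0 at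
   the first times when the counter gets closer to 0 than ever before. *)
Fixpoint levels (s : bool) (n : nat) q w : Prop :=
  if n is m.+1 then exists w1 q1 b q2 w2,
    [/\ w = w1 ++ seq_of_opt b ++ w2, D q q1 w1, edge q1 b (Some (~~ s)) q2,
        s || ~~ nonneg q1 & levels s m q2 w2]
  else D q qf w.

Lemma oca_cfg_complete w : run q0 0%R w qf 0%R -> D q0 qf w.
Proof.
(* Removing the first edge of a run leaves one that starts at any height; [levels] is the form of
   the claim that survives this. *)
suff gen_levels q z q' z' : run q z w q' z' -> q' = qf -> z' = 0%R ->
    (nonneg q -> 0 <= z)%R ->
    forall s n, z = (step s * n%:Z)%R -> levels s n q w.
  by move=> r; apply: (gen_levels _ _ _ _ r _ _ _ true 0%N) => //; lia.
elim=> {q z w q' z'} [q z -> -> _ s n zn|q z a d q1 w q' z' e n1 _ IH qf' z0 nq s n zn].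
  suff -> : n = 0%N by exact: D0.
  by move: zn; rewrite /step; case: (s); lia.
subst q' z'; move: {IH}(IH erefl erefl n1) => IH; case: d => [t|] /= in e n1 IH *; last first.
  move: (IH s n); rewrite addr0 => /(_ zn); case: n {zn IH} => [|n] /=; first exact: D1.
  move=> [w1 [q2 [b [q3 [w2 [-> g e2 n2 l]]]]]].
  exists (seq_of_opt a ++ w1), q2, b, q3, w2; rewrite catA; split=> //.
  exact: D1 g.
(* At height 0 the edge opens an excursion, which the first cut of the remaining run closes. *)
case: n zn => [|n] zn.
  have /IH /= : (z + step t)%R = (step t * 1%N%:Z)%R by lia.
  by move=> [w1 [q2 [b [q3 [w2 [-> g e2 n2 l]]]]]]; exact: D2 e e2 n2 g l.
(* A step away from 0 merges with the first two blocks of the rest, and the cut between them, into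
   one block; a step towards 0 is itself a cut after an empty block. *)
have [ts|ts] := eqVneq t s.
  have /IH /= : (z + step t)%R = (step s * n.+2%:Z)%R by rewrite zn ts; lia.
  move=> [w1 [q2 [b [q3 [w2 [-> g e2 n2]]]]]].
  move=> [w3 [q4 [b' [q5 [w4 [-> g' e4 n4 l]]]]]].
  exists (seq_of_opt a ++ w1 ++ seq_of_opt b ++ w3), q4, b', q5, w4.
  by rewrite -!catA; split=> //; rewrite -ts in e2 n2; exact: D2 e e2 n2 g g'.
have {}ts : t = ~~ s by case: (t) (s) ts => [] [].
have /IH l : (z + step t)%R = (step s * n%:Z)%R.
  by rewrite zn ts /step; case: (s) => /=; lia.
exists [::], q, a, q1, w; split=> //; first by rewrite -ts.
by apply/orP; case: (s) zn => zn; [left|right; apply/negP => /nq; move: zn => /=; lia].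
Qed.

Lemma oca_cfgP w : cfg_lang G w <-> run q0 0%R w qf 0%R.
Proof.
rewrite cfg_langE; split=> [|/oca_cfg_complete g].
  move E: [:: _] => s g; case: g E => // A rhs s' {}w Ar + [EA Es].
  rewrite -{}EA -{}Es cats0 !inE !mem_cat in Ar *.
  move: Ar => /or4P[/eqP[->] /oca_cfg_sound|||]; first exact.
  - by move=> /mapP[].
  - by move=> /mapP[[[[? ?] ?] ?] _ []].
  - by move=> /mapP[[[[[[[[? ?] ?] ?] ?] ?] ?] ?] _ []].
apply: (@gen_rule _ G _ [:: inl (Some (q0, qf))]); last by rewrite cats0.
exact: mem_head.
Qed.

End Correct.
End OCA.

Lemma context_free_oca (T : finType) (M : oca T) q0 qf :
  context_free_language (fun w => @run T M q0 0%R w qf 0%R).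
Proof. by exists (oca_cfg q0 qf) => w; rewrite oca_cfgP. Qed.

(** * Substitution in the words read by a one-counter automaton *)

Section Expansion.
Variables (B : oca (option bool)) (A L : finType).
Variables (rho : A -> seq bool) (lab : bool -> A -> L) (sep : option L).
Local Notation Q := (oca_state B).
Local Notation edge := (@oca_edge _ B).
Implicit Types (c : bool) (u v : seq A) (q : Q) (z : int).

Definition subst (w : seq A) : seq bool := flatten (map rho w).

Definition hash (T : Type) (u v : seq T) : seq (option T) :=
  map Some u ++ None :: map Some v.

(** The successor leaves room for the separator even if every [rho a] is empty. *)
Definition expand_bound := (\max_a size (rho a)).+1.
Local Notation N := expand_bound.

Let S : finType := (bool * Q * {bseq N of option bool})%type.

(* The buffer holds the part of the word to be read by B that comes from the
   letter read last; the boolean tells on which side of the separator it is. *)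
Definition expand_edge (x : S) (a : option L) (d : option bool) (y : S) : bool :=
  let: (c, q, s) := x in let: (c', q', s') := y in
  [|| [exists l, [&& a == Some (lab c l), d == None, c' == c, q' == q,
        s == [::] :> seq _ & s' == map Some (rho l) :> seq _]],
      [&& a == sep, d == None, ~~ c, c', q' == q, s == [::] :> seq _
        & s' == [:: None] :> seq _],
      [&& a == None, c' == c, s' == s & edge q None d q'] |
      [&& a == None, c' == c
        & if s : seq _ is b :: t then (s' == t :> seq _) && edge q (Some b) d q'
          else false]].

Definition expand_nonneg : pred S := fun x => oca_nonneg x.1.2.

Lemma expand_nonneg_edge x a d y :
  expand_edge x a d y -> expand_nonneg x -> expand_nonneg y.
Proof.
case: x y => [[c q] s] [[c' q'] s'] /or4P[/existsP[l]||/and4P[_ _ _]|/and3P[_ _]].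
- by case/and5P=> _ _ _ /eqP ->.
- by case/and5P=> _ _ _ _ /and3P[/eqP ->].
- exact: oca_nonneg_edge.
- by case: (s : seq _) => // b t /andP[_]; exact: oca_nonneg_edge.
Qed.

Definition expand_oca : oca L := OCA expand_nonneg_edge.
Local Notation xrun := (@run L expand_oca).
Local Notation nonneg := (@oca_nonneg _ B).

(** The input still ahead of the buffer on side [c]; [pending_code] is its expansion for [B]. With
    [sep = None] the separator is crossed silently. *)
Definition pending_word c u v : seq L :=
  if c then map (lab true) v
  else map (lab false) u ++ seq_of_opt sep ++ map (lab true) v.

Definition pending_code c u v : seq (option bool) :=
  if c then map Some (subst v) else hash (subst u) (subst v).

Lemma subst_cons a w : subst (a :: w) = rho a ++ subst w.
Proof. by []. Qed.

Lemma subst_cat w1 w2 : subst (w1 ++ w2) = subst w1 ++ subst w2.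
Proof. by rewrite /subst map_cat flatten_cat. Qed.

Lemma expand_sound c q s z l q' z' :
  xrun (c, q, s) z l (true, q', [bseq]) z' ->
  exists u v, l = pending_word c u v /\ run q z (s ++ pending_code c u v) q' z'.
Proof.
move X: (c, q, s) => x; move Y: (true, q', _) => y r.
elim: r c q s q' X Y => {x z l y z'} [x z|x z a d x1 l y z' e n _ IH] c q s q' X Y.
  by move: X; rewrite -Y => -[-> -> ->]; exists [::], [::]; split=> //; constructor.
case: x1 e n IH => [[c1 q1] s1] e n /(_ c1 q1 s1 q' erefl Y) [u [v [-> r]]].
move: e n; rewrite -X /= => /or4P[/existsP[b]||/and4P[]|/and3P[]].
- move=> /and5P[/eqP -> /eqP dN /eqP cc /eqP qq /andP[/eqP sN /eqP s1E]] _.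
  move: r; rewrite dN addr0 qq cc s1E sN /pending_word /pending_code.
  case: c {X cc} => r; first by exists u, (b :: v); split=> //=; rewrite subst_cons map_cat.
  exists (b :: u), v; split=> //=.
  by rewrite /hash subst_cons map_cat -catA.
- move=> /and5P[/eqP -> /eqP dN /negbTE -> cc /and3P[/eqP qq /eqP sN /eqP s1E]] _.
  by move: r; rewrite dN addr0 qq cc s1E sN; exists [::], v.
- move=> /eqP -> /eqP cc /eqP ss e n; exists u, v; split; first by rewrite cc.
  by apply: run_cons e n _; rewrite -cc -ss.
- move=> /eqP -> /eqP cc; case sE: (s : seq _) => [//|b t] /andP[/eqP ss e] n.
  exists u, v; split; first by rewrite cc.
  rewrite cat_cons -cat1s; apply: (@run_cons _ _ _ _ (Some b)) e n _.
  by rewrite -cc -ss.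
Qed.

(** With an empty buffer, letters are loaded until one has a nonempty image or the input ends;
    letters with empty image must be passed over before [B] can read on. *)
Lemma expand_load q z c u v : (nonneg q -> 0 <= z)%R ->
  (pending_code c u v = [::] /\
     xrun (c, q, [bseq]) z (pending_word c u v) (true, q, [bseq]) z) \/
  exists b (s : {bseq N of option bool}) c' u' v',
    [/\ s = b :: behead s :> seq _, pending_code c u v = s ++ pending_code c' u' v' &
     forall y z', xrun (c', q, s) z (pending_word c' u' v') y z' ->
       xrun (c, q, [bseq]) z (pending_word c u v) y z'].
Proof.
move=> n.
have xstep c1 a c' (s : {bseq N of option bool}) l y z' :
    expand_edge (c1, q, [bseq]) a None (c', q, s) ->
    xrun (c', q, s) z l y z' -> xrun (c1, q, [bseq]) z (seq_of_opt a ++ l) y z'.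
  by move=> e r; apply: (@run_cons _ expand_oca _ _ _ _ _ _ _ _ e) => [/n|]; rewrite /= addr0.
pose C u1 v1 := (pending_code c u1 v1 = [::] /\
     xrun (c, q, [bseq]) z (pending_word c u1 v1) (true, q, [bseq]) z) \/
  exists b (s : {bseq N of option bool}) c' u' v',
    [/\ s = b :: behead s :> seq _, pending_code c u1 v1 = s ++ pending_code c' u' v' &
     forall y z', xrun (c', q, s) z (pending_word c' u' v') y z' ->
       xrun (c, q, [bseq]) z (pending_word c u1 v1) y z'].
have load a u1 v1 u2 v2 :
    pending_code c u2 v2 = map Some (rho a) ++ pending_code c u1 v1 ->
    pending_word c u2 v2 = lab c a :: pending_word c u1 v1 -> C u1 v1 -> C u2 v2.
  move=> cE wE.
  have hs : size (map Some (rho a)) <= N.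
    by rewrite size_map; apply: leqW; exact: (leq_bigmax a).
  have e (s : {bseq N of option bool}) : s = map Some (rho a) :> seq _ ->
      expand_edge (c, q, [bseq]) (Some (lab c a)) None (c, q, s).
    by rewrite /= => ->; apply/orP; left; apply/existsP; exists a; rewrite !eqxx.
  case aE: (map Some (rho a)) => [|b t].
    have {e}st := xstep c _ c [bseq] _ _ _ (e [bseq] (esym aE)).
    rewrite aE /= in cE => -[[cN r]|[b [s [c' [u' [v' [sE cE' r]]]]]]].
      by left; rewrite cE wE; split=> //; exact: st.
    by right; exists b, s, c', u', v'; rewrite cE wE; split=> // y z' /r; exact: st.
  move=> _; right; exists b, (Bseq hs), c, u1, v1; rewrite cE wE; split=> //=.
    by rewrite aE.
  by move=> y z'; exact: xstep (e (Bseq hs) erefl).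
rewrite -/(C u v); case: c @C load => C load.
  elim: v => [|a v IH]; first by left; split=> //; constructor.
  by apply: load IH => //; rewrite /pending_code subst_cons map_cat.
elim: u => [|a u IH].
  have hs : size [:: @None bool] <= N by [].
  right; exists None, (Bseq hs), true, [::], v; split=> // y z' r.
  by apply: (xstep false sep _ _ _ _ _ _ r); apply/orP; right; apply/orP; left; rewrite !eqxx.
by apply: load IH => //; rewrite /pending_code /hash subst_cons map_cat catA.
Qed.

Lemma expand_complete c q (s : {bseq N of option bool}) z u v x q' z' :
  run q z x q' z' -> (nonneg q -> 0 <= z)%R -> x = s ++ pending_code c u v ->
  xrun (c, q, s) z (pending_word c u v) (true, q', [bseq]) z'.
Proof.
move=> r; elim: r c s u v => {q z x q' z'} [q z|q z a d q1 x q' z' e n1 _ IH] c s u v n.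
  case: (expand_load c u v n) => [[_ r] sN|[b [s' [c' [u' [v' [sE cE _]]]]]]].
    suff -> : s = [bseq] by [].
    by case: s sN => -[|//] hs _; exact: val_inj.
  by rewrite cE sE; case: (bseqval s).
have cons c1 (s1 s2 : {bseq N of option bool}) l y :
    expand_edge (c1, q, s1) None d (c1, q1, s2) ->
    xrun (c1, q1, s2) (z + weight d)%R l y z' -> xrun (c1, q, s1) z l y z'.
  by move=> e1 r1; exact: (@run_cons _ expand_oca (c1, q, s1) z None d _ _ _ _ e1 n1 r1).
case: a e => [b|] e xE; last first.
  apply: cons (IH c s u v n1 xE).
  by apply/or4P/Or43; rewrite !eqxx.
have read c1 (s1 : {bseq N of option bool}) u1 v1 : s1 = b :: behead s1 :> seq _ ->
    b :: x = s1 ++ pending_code c1 u1 v1 ->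
    xrun (c1, q, s1) z (pending_word c1 u1 v1) (true, q', [bseq]) z'.
  case: s1 => -[//|b1 t] h /= _ [<- xt]; have ht := ltnW h.
  apply: cons (IH c1 (Bseq ht) u1 v1 n1 xt).
  by apply/or4P/Or44; rewrite /= !eqxx.
case sE: (bseqval s) => [|b1 t].
  have -> : s = [bseq] by exact: val_inj.
  rewrite sE /= in xE.
  case: (expand_load c u v n) => [[]|[b' [s' [c' [u' [v' [s'E cE r]]]]]]].
    by rewrite -xE.
  by apply/r/read; rewrite -?cE //; move: xE; rewrite cE s'E /= => -[->].
by apply: read => //; move: xE; rewrite sE /= => -[->].
Qed.

Definition hash_word (u v : seq A) : seq L :=
  map (lab false) u ++ seq_of_opt sep ++ map (lab true) v.

(** This amounts to an inverse homomorphism, carried out on automata. The labels [lab] and the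
    optional [sep] let it serve both versions of the problem. *)
Lemma context_free_expansion q0 qf (P : seq bool -> seq bool -> Prop) :
  (forall x y, run q0 0%R (hash x y) qf 0%R <-> P x y) ->
  context_free_language (fun l => exists u v,
    l = hash_word u v /\ P (subst u) (subst v)).
Proof.
move=> PB.
have [G GL] := @context_free_oca _ expand_oca (false, q0, [bseq]) (true, qf, [bseq]).
exists G => l; rewrite -GL; split=> [[u [v [-> /PB r]]]|/expand_sound[u [v [-> r]]]].
  by apply: (expand_complete (c := false) (s := [bseq]) r).
by exists u, v; split; last exact/PB.
Qed.
End Expansion.

(** * Walks on the integers *)

Section Walks.
Implicit Types (s : bool) (u v w : seq bool).

(* A word over bool is a walk on the integers that starts at 0, [true] being the
   step +1; [height] is its end point and [peak] the maximum that it reaches. *)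
Definition height w : int := foldr (fun s z => step s + z)%R 0%R w.
Definition peak w : nat := foldr (fun s n => if s then n.+1 else n.-1) 0 w.
Definition reverse w : seq bool := rev (map negb w).

Lemma height_cat u v : height (u ++ v) = (height u + height v)%R.
Proof. by elim: u => /= [|s u ->]; rewrite ?add0r ?addrA. Qed.

Lemma peak_cat u v :
  Posz (peak (u ++ v)) = Num.max (Posz (peak u)) (height u + Posz (peak v))%R.
Proof. by elim: u => [|s u IH] /=; [|case: s; rewrite /step]; lia. Qed.

Lemma reverse_cons s w : reverse (s :: w) = rcons (reverse w) (~~ s).
Proof. by rewrite /reverse /= rev_cons. Qed.

Lemma reverse_cat u v : reverse (u ++ v) = reverse v ++ reverse u.
Proof. by rewrite /reverse map_cat rev_cat. Qed.

Lemma reverseK : involutive reverse.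
Proof.
move=> w; rewrite /reverse map_rev revK -map_comp -[RHS]map_id.
by apply: eq_map => s /=; exact: negbK.
Qed.

Lemma height_reverse w : height (reverse w) = (- height w)%R.
Proof.
elim: w => [//|s w IH]; rewrite reverse_cons -cats1 height_cat IH /=.
by case: s; rewrite /step /=; lia.
Qed.

(** The reversed walk starts at the old end point, so its peak is the old maximum measured from
    there. *)
Lemma peak_reverse w : Posz (peak (reverse w)) = (Posz (peak w) - height w)%R.
Proof.
elim: w => [//|s w IH]; rewrite reverse_cons -cats1 peak_cat IH height_reverse /=.
by case: s; rewrite /step /=; lia.
Qed.

Lemma peak_prefix w : exists w1 w2,
  [/\ w = w1 ++ w2, height w1 = Posz (peak w) & peak w1 = peak w].
Proof.
elim: w => [|s w [w1 [w2 [-> h p]]]]; first by exists [::], [::].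
case: (posnP (peak (s :: w1 ++ w2))) => [->|pos]; first by exists [::], (s :: w1 ++ w2).
exists (s :: w1), w2; rewrite /= h p; split=> //.
by move: pos; case: (s); rewrite /step /=; lia.
Qed.

Lemma peak_suffix w : exists w1 w2, w = w1 ++ w2 /\ (- height w2)%R = Posz (peak (reverse w)).
Proof.
have [w1 [w2 [e h _]]] := peak_prefix (reverse w).
exists (reverse w2), (reverse w1); split; last by rewrite height_reverse opprK.
by rewrite -reverse_cat -e reverseK.
Qed.

End Walks.

(** * Runs that stay in one state *)

Section Runs.
Variable M : oca (option bool).
Local Notation Q := (oca_state M).
Local Notation edge := (@oca_edge _ M).
Local Notation nonneg := (@oca_nonneg _ M).
Local Notation run := (@run _ M).
Implicit Types (q : Q) (z : int) (w : seq bool).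

(** With the end configuration fixed, [P] can say, state by state, which words lead there from a
    given counter value. *)
Lemma run_ind_to q' z' (P : Q -> int -> seq (option bool) -> Prop) :
  P q' z' [::] ->
  (forall q z a d q1 l, edge q a d q1 -> (nonneg q1 -> 0 <= z + weight d)%R ->
     P q1 (z + weight d)%R l -> P q z (seq_of_opt a ++ l)) ->
  forall q z l, run q z l q' z' -> P q z l.
Proof.
move=> P0 PS q z l; move Eq: q' P0 => x; move Ez: z' => y P0 r.
by elim: r P0 Eq Ez => // {}q {}z a d q1 {}l x' y' e n _ IH P0 Eq Ez; apply: PS e n (IH _ _ _).
Qed.

Lemma run_skip q z w : (forall s, edge q (Some (Some s)) None q) ->
  (nonneg q -> 0 <= z)%R -> run q z (map Some w) q z.
Proof.
move=> e n; elim: w => [|s w IH] /=; first by constructor.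
rewrite -cat1s; apply: (run_cons (e s)); rewrite /= addr0 //.
Qed.

(** The counter holds [z] minus the current height of the walk, and is lowest at the peak. *)
Lemma run_descend q z w : (forall s, edge q (Some (Some s)) (Some (~~ s)) q) ->
  (nonneg q -> Posz (peak w) <= z)%R -> run q z (map Some w) q (z - height w)%R.
Proof.
move=> e; elim: w z => [|s w IH] z n /=; first by rewrite subr0; constructor.
rewrite -cat1s; apply: (run_cons (e s)) => [/n|] /=.
  by case: s {n}; rewrite /step /=; lia.
have -> : (z - (step s + height w) = z + step (~~ s) - height w)%R.
  by case: s {n}; rewrite /step /=; lia.
by apply: IH => /n /=; case: s {n}; rewrite /step /=; lia.
Qed.

Lemma run_ascend q z w : (forall s, edge q (Some (Some s)) (Some s) q) ->
  ~~ nonneg q -> run q z (map Some w) q (z + height w)%R.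
Proof.
move=> e n; elim: w z => [|s w IH] z /=; first by rewrite addr0; constructor.
rewrite -cat1s addrA; apply: (run_cons (e s)) => [|//].
by move=> h; rewrite h in n.
Qed.

Lemma run_lower q z : edge q None (Some false) q -> (0 <= z)%R -> run q z [::] q 0%R.
Proof.
case: z => // n e _; elim: n => [|n IH]; first by constructor.
apply: (run_cons e) => /=; first by rewrite /step; lia.
by rewrite (_ : (_ + _)%R = Posz n) //; rewrite /step; lia.
Qed.

Lemma run_raise q z : edge q None (Some true) q -> (0 <= z)%R -> run q 0%R [::] q z.
Proof.
move=> e z0; rewrite -[z]add0r; case: z z0 => // n _.
suff: forall y, (0 <= y)%R -> run q y [::] q (y + Posz n)%R by apply.
elim: n => [|n IH] y y0; first by rewrite addr0; constructor.
apply: (run_cons e) => /=; first by rewrite /step; lia.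
by rewrite (_ : (y + _ = y + step true + Posz n)%R); [apply: IH|]; rewrite /step; lia.
Qed.

End Runs.

(** * Automata comparing two walks *)

(* In the three automata below, [None] is the initial and [Some true] the final
   state, and the letter [Some None] is the separator. *)

(** The counter adds up both heights, the second one negated if [b]. The separator costs one and the
    last state may only lower the counter silently, so 0 is reached exactly when the sum is
    positive. *)
Definition sum_edge (b : bool) (q : option bool) (a : option (option bool))
    (d q' : option bool) : bool :=
  match q, a, q' with
  | None, Some (Some s), None => d == Some s
  | None, Some None, Some true => d == Some false
  | Some true, Some (Some s), Some true => d == Some (s (+) b)
  | Some true, None, Some true => d == Some false
  | _, _, _ => false
  end.

Definition sum_oca b : oca (option bool) :=
  @OCA _ _ (sum_edge b) xpred0 (fun _ _ _ _ _ => id).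

Lemma sum_ocaP b u v :
  run (M := sum_oca b) None 0%R (hash u v) (Some true) 0%R <->
  (0 < height u + if b then - height v else height v)%R.
Proof.
split=> [|pos].
  pose P (q : oca_state (sum_oca b)) (z : int) l := match q with
    | None => forall u v, l = hash u v ->
        (0 < z + height u + if b then - height v else height v)%R
    | _ => forall v, l = map Some v -> (0 <= z + if b then - height v else height v)%R
    end.
  move/(@run_ind_to _ _ _ P); rewrite /P -[height u in X in _ -> X]add0r; apply=> //.
    by case: (b) => -[].
  case=> [[]|] z [[s|]|] d [[]|] l //= /eqP -> _ H.
  - by move=> [|s' {}v] //= [<- /H]; case: (b) (s) => [] []; rewrite /step /=; lia.
  - by move=> {}v /H; case: (b); rewrite /= /step; lia.
  - by move=> [|s' {}u] {}v //= [<- /H]; case: (b); rewrite /= /step; lia.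
  - by move=> [|s' {}u] {}v //= [/H]; case: (b); rewrite /= /step; lia.
have r1 : run (M := sum_oca b) None 0%R (map Some u) None (height u).
  by rewrite -[height u]add0r; apply: run_ascend => // s /=.
have r2 z : run (M := sum_oca b) (Some true) z (map Some v) (Some true)
    (z + if b then - height v else height v)%R.
  by case: b {r1 pos}; [apply: run_descend|apply: run_ascend] => // -[] /=.
apply: run_cat r1 _; rewrite -cat1s.
apply: (@run_cons _ (sum_oca b) None _ (Some None) (Some false) (Some true)) => //=.
rewrite -[map _ _]cats0; apply: run_cat (r2 _) _; apply: run_lower => //=.
by move: pos; case: (b); rewrite /step; lia.
Qed.

(* Guesses where the first walk is highest (from its start if b, relatively to its
   end if not b); the counter then stores that peak, and has to stay nonnegative
   along the second walk. *)
Definition above_edge (b : bool) (q : option bool) (a : option (option bool))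
    (d q' : option bool) : bool :=
  match q, a, q' with
  | None, Some (Some s), None => d == if b then Some s else None
  | None, None, Some false => d == None
  | Some false, Some (Some s), Some false => d == if b then None else Some (~~ s)
  | Some false, Some None, Some true => d == Some false
  | Some true, Some (Some s), Some true => d == Some (~~ s)
  | Some true, None, Some true => d == Some false
  | _, _, _ => false
  end.

Lemma above_edge_nonneg b q a d q' :
  above_edge b q a d q' -> q == Some true -> q' == Some true.
Proof. by case: q a q' => [[]|] [[s|]|] [[]|]. Qed.

Definition above_oca b : oca (option bool) := OCA (@above_edge_nonneg b).

Lemma above_ocaP b u v :
  run (M := above_oca b) None 0%R (hash u v) (Some true) 0%R <->
  peak v < if b then peak u else peak (reverse u).
Proof.
split=> [|lt].
  (* In [Some true] the bound needs [0 <= z], which the mark of that state supplies on entry. *)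
  pose P (q : oca_state (above_oca b)) (z : int) l := match q with
    | None => forall u v, l = hash u v ->
        (Posz (peak v) < z + Posz (if b then peak u else peak (reverse u)))%R
    | Some false => forall u v, l = hash u v ->
        (Posz (peak v) < z - if b then 0 else height u)%R
    | Some true => (0 <= z)%R -> forall v, l = map Some v -> (Posz (peak v) <= z)%R
    end.
  move/(@run_ind_to _ _ _ P); rewrite /P => H.
  suff: (Posz (peak v) < 0 + Posz (if b then peak u else peak (reverse u)))%R by lia.
  apply: H erefl => {u v}; first by move=> _ [].
  case=> [[]|] z [[s|]|] d [[]|] l //= /eqP -> n H.
  - by move=> z0 [|s' v] //= [<- /(H (n isT))]; case: (s) n; rewrite /= /step; lia.
  - by move=> z0 v /(H (n isT)); rewrite /= /step; lia.
  - by move=> [|s' u] v //= [<- /H]; case: (b) (s) => [] []; rewrite /= /step; lia.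
  - move=> [|s' u] v //= [vE]; move: (H (n isT) v vE) (n isT).
    by case: (b); rewrite /= /step; lia.
  - move=> [|s' u] v //= [<- /H]; have := peak_reverse u; have := peak_reverse (s :: u).
    by case: (b) (s) => [] []; rewrite /= /step; lia.
  - by move=> u v /H; rewrite /= addr0; case: (b); have := peak_reverse u; lia.
have [z zv r] : exists2 z : int, (Posz (peak v) < z)%R &
    run (M := above_oca b) None 0%R (map Some u) (Some false) z.
  have guess z : run (M := above_oca b) None z [::] (Some false) z.
    apply: (@run_cons _ (above_oca b) None z None None (Some false)) => //=.
    by rewrite addr0; constructor.
  case: b lt guess => lt guess.
    have [u1 [u2 [uE h _]]] := peak_prefix u.
    exists (Posz (peak u)); first by lia.
    have r1 : run (M := above_oca true) None 0%R (map Some u1) None (0 + height u1)%R.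
      by apply: run_ascend => /=.
    rewrite add0r h in r1; rewrite [in map Some u]uE map_cat; apply: run_cat r1 _.
    by apply: (run_cat (guess _)); apply: run_skip => /=.
  have [u1 [u2 [uE h]]] := peak_suffix u.
  exists (Posz (peak (reverse u))); first by lia.
  have r1 : run (M := above_oca false) None 0%R (map Some u1) None 0%R.
    by apply: run_skip => /=.
  rewrite [in map Some u]uE map_cat; apply: run_cat r1 _.
  rewrite -h -[(- _)%R]add0r; apply: (run_cat (guess _)).
  by apply: run_descend => // -[].
apply: run_cat r _; rewrite -cat1s.
apply: (@run_cons _ (above_oca b) (Some false) _ (Some None) (Some false) (Some true)) => //=.
  by rewrite /step; lia.
rewrite -[map _ _]cats0; apply: run_cat (run_descend _ _) (run_lower _ _) => //=.
  by rewrite /step; lia.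
(* Appending the empty walk yields [height v <= peak v]. *)
have := peak_cat v [::]; rewrite cats0 /= /step; lia.
Qed.

(* Guesses a bound on the first walk, whose distance to the end of that walk is
   stored in the counter; the second walk then has to climb above it. *)
Definition below_edge (q : option bool) (a : option (option bool))
    (d q' : option bool) : bool :=
  match q, a, q' with
  | None, Some (Some s), None => d == Some (~~ s)
  | None, None, None => d == Some true
  | None, Some None, Some false => d == Some true
  | Some false, Some (Some s), Some false => d == Some (~~ s)
  | Some false, None, Some true => d == None
  | Some true, Some (Some s), Some true => d == None
  | _, _, _ => false
  end.

Definition below_oca : oca (option bool) :=
  @OCA _ _ below_edge xpredT (fun _ _ _ _ _ => id).

Lemma below_ocaP u v :
  run (M := below_oca) None 0%R (hash u v) (Some true) 0%R <->
  peak (reverse u) < peak v.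
Proof.
split=> [|lt].
  (* The bound on [z - height u] is needed when the first walk is highest at its start: there
     [0 <= z] turns it into the comparison of peaks. *)
  pose P (q : oca_state below_oca) (z : int) l := match q with
    | None => (0 <= z)%R -> forall u v, l = hash u v ->
        peak (reverse u) < peak v /\ (z - height u < Posz (peak v))%R
    | Some false => forall v, l = map Some v -> (z <= Posz (peak v))%R
    | Some true => z = 0%R
    end.
  move/(@run_ind_to _ _ _ P) => H.
  suff /(_ isT u v erefl)[//] : P None 0%R (hash u v).
  apply: H => // {u v}; case=> [[]|] z [[s|]|] d [[]|] l //= /eqP -> n.
  - by rewrite addr0.
  - by move=> H [|s' v] //= [<- /H]; case: (s); rewrite /step /=; lia.
  - by rewrite addr0 => -> v _; lia.
  - move=> H z0 [|s' u] v //= [<- /(H (n isT))[]]; have := peak_reverse u.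
    have := peak_reverse (s :: u); case: (s); rewrite /= /step; lia.
  - move=> H z0 [|s' u] v //= [/H]; rewrite /= /step; lia.
  - move=> H z0 u v /(H (n isT)); rewrite /= /step; lia.
(* Chosen so that the counter equals [peak v] after the first walk and the increment at the
   separator. *)
pose z := (Posz (peak v) - 1 + height u)%R.
have zu : (Posz (peak u) <= z)%R by have := peak_reverse u; lia.
apply: (@run_cat _ below_oca _ _ [::] None z); first by apply: run_raise => //; lia.
apply: run_cat (run_descend _ _) _ => //=; rewrite -cat1s.
apply: (@run_cons _ below_oca None _ (Some None) (Some true) (Some false)) => //=.
  by rewrite /step; lia.
have -> : (z - height u + step true = Posz (peak v))%R by rewrite /step; lia.
have [v1 [v2 [vE h p]]] := peak_prefix v.
rewrite [in map Some v]vE map_cat; apply: run_cat (run_descend _ _) _ => //=.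
  by rewrite p.
rewrite h subrr; apply: (@run_cons _ below_oca (Some false) _ None None (Some true)) => //=.
by rewrite addr0; apply: run_skip.
Qed.

(** * The free inverse monoid of rank one *)

(** [b = false] mirrors the walk, so that its peak becomes minus the original minimum. *)
Definition sign (X : Type) (b : bool) (a : pm X) : bool :=
  if a is inl _ then b else ~~ b.

Lemma map_sign_winv (X : Type) b (w : seq (pm X)) :
  map (sign b) (winv w) = reverse (map (sign b) w).
Proof.
rewrite /winv /reverse map_rev -!map_comp; congr rev; apply: eq_map.
by case=> x //=; rewrite negbK.
Qed.

Lemma map_signN (X : Type) b (w : seq (pm X)) :
  map (sign (~~ b)) w = map negb (map (sign b) w).
Proof. by rewrite -map_comp; apply: eq_map => -[]. Qed.

Lemma height_negb w : height (map negb w) = (- height w)%R.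
Proof. by elim: w => //= s w ->; case: s; rewrite /step /=; lia. Qed.

(** Retracing a walk reaches no new point, and the two loops in the commutation relation both return
    to the origin. *)
Lemma fim_cong_walk (X : Type) b (u v : seq (pm X)) : fim_cong u v ->
  height (map (sign b) u) = height (map (sign b) v) /\
  peak (map (sign b) u) = peak (map (sign b) v).
Proof.
elim=> {u v} [//|u v _ [-> ->] //|u v w _ [-> ->] //| | |].
- move=> u u' v v' _ [h p] _ [h' p']; rewrite !map_cat !height_cat.
  split; first by rewrite h h'.
  by apply: (@can_inj _ _ Posz absz) => //; rewrite !peak_cat h p p'.
- move=> u; rewrite !map_cat !map_sign_winv; set w := map _ u.
  have := peak_cat w (reverse w ++ w); have := peak_cat (reverse w) w.
  have := height_reverse w; have := peak_reverse w.
  by rewrite !height_cat; split; lia.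
- move=> u v; rewrite !map_cat !map_sign_winv; set w := map _ u; set x := map _ v.
  have := height_reverse w; have := peak_reverse w.
  have := height_reverse x; have := peak_reverse x.
  have := peak_cat w (reverse w ++ x ++ reverse x); have := peak_cat (reverse w) (x ++ reverse x).
  have := peak_cat x (reverse x); have := peak_cat w (reverse w).
  have := peak_cat x (reverse x ++ w ++ reverse w); have := peak_cat (reverse x) (w ++ reverse w).
  by rewrite !height_cat; split; lia.
Qed.

(** * Normal forms in terms of one element and its inverse *)

Section NormalForm.
Variable X : choiceType.
Implicit Types (x y : FIM X) (n p m : nat) (z : int).
Local Open Scope group_scope.

Definition idem x n : FIM X := x ^+ n * (x ^+ n)^-1.
Definition shift x z : FIM X :=
  match z with Posz n => x ^+ n | Negz n => x^-1 ^+ n.+1 end.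
(** The element whose walk covers the interval from [-m] to [p] and ends at [z]. *)
Definition normal_form x p m z : FIM X := idem x p * idem x^-1 m * shift x z.

Lemma idemC x y n p : idem x n * idem y p = idem y p * idem x n.
Proof. exact: fim_mulVC. Qed.

Lemma idem_idem x n : idem x n * idem x n = idem x n.
Proof. by rewrite /idem mulgA fim_mulVK. Qed.

(** Write [x] as [x * x^-1 * x] and commute the idempotent [x^-1 * x] with [idem x n]. *)
Lemma mul_idem x n : x * idem x n = idem x n.+1 * x.
Proof.
have c : x^-1 * x * idem x n = idem x n * (x^-1 * x).
  by have := fim_mulVC x^-1 (x ^+ n); rewrite invgK.
rewrite -{1}[x]fim_mulVK -!mulgA [x^-1 * _]mulgA c /idem expgS invgM.
by rewrite !mulgA.
Qed.

Lemma mul_idemV x m : x * idem x^-1 m = idem x 1 * idem x^-1 m.-1 * x.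
Proof.
case: m => [|m] /=.
  by rewrite /idem !expg0 invg1 !mulg1 fim_mulVK.
by rewrite /idem expgS expg1 invgM invgK !mulgA.
Qed.

(** For negative [z] the product [x * x^-1] does not cancel but leaves [idem x 1]; for other [z]
    this factor is harmless. *)
Lemma mul_shift x z : x * shift x z = idem x 1 * shift x (z + 1)%R.
Proof.
case: z => [n|[|n]].
- have -> : (Posz n + 1 = Posz n.+1)%R by lia.
  by rewrite /= expgS /idem expg1 !mulgA fim_mulVK.
- have -> : (Negz 0 + 1 = 0)%R by [].
  by rewrite /= /idem !expg1 mulg1.
- have -> : (Negz n.+1 + 1 = Negz n)%R by lia.
  by rewrite /= [_ ^+ n.+2]expgS /idem expg1 mulgA.
Qed.

Lemma idem_absorb x n : idem x n.+1 * idem x 1 = idem x n.+1.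
Proof. by rewrite idemC /idem expg1 [x ^+ n.+1]expgS !mulgA fim_mulVK. Qed.

(** A step up in front shifts the interval by one and adjoins the new origin, hence [m.-1] with
    [0.-1 = 0]: the recursion of [peak]. *)
Lemma mul_normal_form x p m z :
  x * normal_form x p m z = normal_form x p.+1 m.-1 (z + 1)%R.
Proof.
rewrite /normal_form.
(* The factors become variables; the two extra copies of [idem x 1] are absorbed by
   [idem x p.+1]. *)
move: (mul_idem x p) (mul_idemV x m) (mul_shift x z) (idemC x x^-1 1 m.-1).
move: (idem_idem x 1) (idem_absorb x p).
move: (idem x p.+1) (idem x p) (idem x^-1 m) (idem x^-1 m.-1) (idem x 1).
move: (shift x z) (shift x (z + 1)%R) => s s' i' i j j' e ee i'e xi xj xs ej.
rewrite !mulgA xi -[i' * x * j]mulgA xj -!mulgA xs [j' * (e * s')]mulgA -ej.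
by rewrite -!mulgA [e * (e * _)]mulgA ee mulgA i'e.
Qed.

Lemma normal_formV x p m z : normal_form x p m z = normal_form x^-1 m p (- z)%R.
Proof.
rewrite /normal_form invgK idemC; congr (_ * _).
by case: z => [[|n]|n] //=; rewrite invgK.
Qed.

Lemma mulV_normal_form x p m z :
  x^-1 * normal_form x p m z = normal_form x p.-1 m.+1 (z - 1)%R.
Proof.
by rewrite normal_formV mul_normal_form normal_formV invgK; congr normal_form; lia.
Qed.
End NormalForm.

(** The completeness half of Munn's description: the three numbers determine the class. *)
Lemma fim1_normal_form (w : seq (pm 'I_1)) :
  fim_class w = normal_form (fim_class [:: inl ord0]) (peak (map (sign true) w))
    (peak (map (sign false) w)) (height (map (sign true) w)).
Proof.
elim: w => [|a w IH]; first by rewrite /normal_form /idem !expg0 invg1 !mulg1.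
rewrite -cat1s fim_class_cat IH; case: a => i; rewrite (ord1 i) /=.
  by rewrite mul_normal_form; congr normal_form; rewrite /step; lia.
have -> : fim_class [:: inr ord0 : pm 'I_1] = ((fim_class [:: inl ord0])^-1)%g.
  by rewrite -fim_class_inv.
by rewrite mulV_normal_form; congr normal_form; rewrite /step; lia.
Qed.

Lemma fim1_classP (u v : seq (pm 'I_1)) : fim_class u = fim_class v <->
  forall b, height (map (sign b) u) = height (map (sign b) v) /\
    peak (map (sign b) u) = peak (map (sign b) v).
Proof.
split=> [/fim_classP uv b|h]; first exact: fim_cong_walk.
have [h1 p1] := h true; have [_ p2] := h false.
by rewrite (fim1_normal_form u) (fim1_normal_form v) h1 p1 p2.
Qed.

(** * Co-word problems *)

Section Generators.
Variable X : {fset 'FIM_1}.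
Local Notation A := (X + X)%type.
Implicit Types (u v : seq A) (b : bool).

(** Using [winv] for formal inverses makes [winv] on words over [X] act as reversal of walks. *)
Definition representative (a : A) : seq (pm 'I_1) :=
  match a with inl x => repr (val x) | inr x => winv (repr (val x)) end.

Definition letter_walk b (a : A) : seq bool := map (sign b) (representative a).
Local Notation walk b := (subst (letter_walk b)).

Lemma walkE b u : walk b u = map (sign b) (flatten (map representative u)).
Proof. by rewrite map_flatten -map_comp. Qed.

Lemma walk_winv b u : walk b (winv u) = reverse (walk b u).
Proof.
elim: u => [//|a u IH].
rewrite -cat1s winv_cat !subst_cat reverse_cat IH /subst /= !cats0; congr (_ ++ _).
by rewrite /letter_walk -map_sign_winv; congr map; case: a => x //=; rewrite winvK.
Qed.

Lemma weval_class u : weval u = fim_class (flatten (map representative u)).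
Proof.
rewrite /weval; elim: u => [|a u IH]; first by rewrite big_nil.
rewrite big_cons IH /= fim_class_cat; congr (_ * _)%g.
by case: a => x /=; rewrite ?fim_class_inv fim_reprK.
Qed.

Lemma weval_eqP u v : weval u = weval v <-> forall b,
  height (walk b u) = height (walk b v) /\ peak (walk b u) = peak (walk b v).
Proof.
by rewrite !weval_class fim1_classP; split=> e b; move: (e b); rewrite -!walkE.
Qed.

Lemma height_walkN b u : height (walk (~~ b) u) = (- height (walk b u))%R.
Proof. by rewrite !walkE map_signN height_negb. Qed.

(** Passing from [b] to [~~ b] negates heights, so one strict inequality covers both ways in which
    end points can differ. *)
Lemma weval_neqP u v : weval u <> weval v <-> exists b,
  [\/ (0 < height (walk b u) - height (walk b v))%R,
      peak (walk b v) < peak (walk b u) | peak (walk b u) < peak (walk b v)].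
Proof.
split=> [|[b d] /weval_eqP/(_ b)[]]; last by case: d; lia.
apply: contra_notP => /forallNP e; apply/weval_eqP => b.
have h : (0 < height (walk b u) - height (walk b v))%R -> False.
  by move=> d; apply: (e b); constructor 1.
have h' : (0 < height (walk (~~ b) u) - height (walk (~~ b) v))%R -> False.
  by move=> d; apply: (e (~~ b)); constructor 1.
have p : ~ peak (walk b v) < peak (walk b u).
  by move=> d; apply: (e b); constructor 2.
have p' : ~ peak (walk b u) < peak (walk b v).
  by move=> d; apply: (e b); constructor 3.
by rewrite !height_walkN in h'; lia.
Qed.

(* Once the heights agree, comparing the peaks of two walks amounts to comparing
   those of the reversed walks. *)
Lemma weval_neq_winvP u v : weval u <> weval v <-> exists b,
  [\/ (0 < height (walk b u) + height (walk b (winv v)))%R,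
      peak (walk b (winv v)) < peak (reverse (walk b u))
    | peak (reverse (walk b u)) < peak (walk b (winv v))].
Proof.
split=> [/weval_neqP[b d]|[b d] /weval_eqP/(_ b)]; last first.
  move: d; rewrite walk_winv height_reverse => d [h p].
  by have := peak_reverse (walk b u); have := peak_reverse (walk b v); case: d; lia.
have [h|h|h] := ltgtP (height (walk b u)) (height (walk b v)).
- by exists (~~ b); constructor 1; rewrite walk_winv height_reverse !height_walkN; lia.
- by exists b; constructor 1; rewrite walk_winv height_reverse; lia.
exists b; rewrite walk_winv.
have := peak_reverse (walk b u); have := peak_reverse (walk b v).
by case: d => d pv pu; [constructor 1|constructor 2|constructor 3]; lia.
Qed.

Lemma coWP_context_free : context_free_language (coWP X).
Proof.
pose P (t : option bool) (x y : seq bool) : bool := match t with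
  | None => (0 < height x + height y)%R
  | Some false => peak y < peak (reverse x)
  | Some true => peak (reverse x) < peak y
  end.
(* The index fixes the orientation and which of the three inequalities is tested. *)
pose L (i : bool * option bool) (l : seq (option A)) := exists u v,
  l = hash_word (fun=> @Some A) (Some None) u v /\ P i.2 (walk i.1 u) (walk i.1 v).
have [[b [[]|]]|G GL] := @context_free_bigcup _ _ L.
- exact: context_free_expansion below_ocaP.
- exact: context_free_expansion (above_ocaP false).
- exact: context_free_expansion (sum_ocaP false).
exists G => l; rewrite -GL; split=> [[u [v [/weval_neq_winvP[b d] ->]]]|].
  case: d => d; [exists (b, None)|exists (b, Some false)|exists (b, Some true)];
    by exists u, (winv v).
move=> [[b t] [u [v [-> d]]]]; exists u, (winv v); rewrite winvK; split=> //.
apply/weval_neq_winvP; exists b; rewrite winvK.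
by case: t d => [[]|] d; [constructor 3|constructor 2|constructor 1].
Qed.

(** One tape is read completely before the other. Reading the second tape first lets the same
    automaton compare peaks in both directions. *)
Lemma coWP2_context_free : context_free_relation (coWP2 X).
Proof.
pose P (t : option bool) (x y : seq bool) : bool :=
  if t is Some _ then peak y < peak x else (0 < height x - height y)%R.
(* [inl] letters belong to the first tape and [inr] letters to the second; [t = Some true] exchanges
   the tapes. *)
pose lab (t : option bool) (c : bool) (a : A) : A + A :=
  if c (+) (t == Some true) then inr a else inl a.
pose L (i : bool * option bool) (l : seq (A + A)) := exists u v,
  l = hash_word (lab i.2) None u v /\ P i.2 (walk i.1 u) (walk i.1 v).
pose tau (a : A + A) := match a with inl x => (Some x, None) | inr x => (None, Some x) end.
have tapes t u v : pmap (fun a => (tau a).1) (hash_word (lab t) None u v) =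
      (if t == Some true then v else u) /\
    pmap (fun a => (tau a).2) (hash_word (lab t) None u v) =
      if t == Some true then u else v.
  have e1 w : pmap (fun a => (tau a).1) (map inl w) = w by elim: w => //= a w ->.
  have e2 w : pmap (fun a => (tau a).2) (map inr w) = w by elim: w => //= a w ->.
  have n1 w : pmap (fun a => (tau a).1) (map inr w) = [::] by elim: w.
  have n2 w : pmap (fun a => (tau a).2) (map inl w) = [::] by elim: w.
  rewrite /hash_word /lab !pmap_cat /=.
  by case: (t == _); rewrite /= !(e1, e2, n1, n2) ?cats0.
apply: (@context_free_relation_of_language _ _ tau (fun l => exists i, L i l)).
  apply: context_free_bigcup => -[b [[]|]].
  - exact: context_free_expansion (above_ocaP true).
  - exact: context_free_expansion (above_ocaP true).
  - exact: context_free_expansion (sum_ocaP true).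
move=> u v; split=> [/weval_neqP[b d]|[l [[[b t] [x [y [-> d]]]] -> ->]]].
  have [t [x [y [xy d']]]] : exists t x y, (u, v) = (if t == Some true then (y, x) else (x, y))
      /\ P t (walk b x) (walk b y).
    case: d => d; [exists None, u, v|exists (Some false), u, v|exists (Some true), v, u];
      by split.
  exists (hash_word (lab t) None x y); have [-> ->] := tapes t x y.
  split; first by exists (b, t), x, y.
    by case: (t == _) xy => -[].
  by case: (t == _) xy => -[].
have [-> ->] := tapes t x y; apply/weval_neqP; exists b.
by case: t d => [[]|] d; [constructor 3|constructor 2|constructor 1].
Qed.

End Generators.

Theorem theorem3 (X : {fset 'FIM_1}) (hX : inv_generates X) :
  context_free_language (coWP X) /\
  context_free_relation (coWP2 X).
Proof.
split; [exact: coWP_context_free | exact: coWP2_context_free].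
Qed.
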